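(* Consider the bottleneck model with a transit outside option, with parameters $\Lambda, \lambda, \mu, e, L, z_C, z_T$ (as described in the context). Suppose $\mu < \lambda$ and users choose between two modes, traveling by car through the bottleneck with free-flow cost $z_C$, and using public transit with fixed cost $z_T$, where $z_T \geq z_C$. Then the revenue-optimal static toll (the constant toll $\tau \ge 0$ maximizing the equilibrium revenue $R(\tau)$) is given by $$\tau^* = \begin{cases} \max\left\{ \dfrac{z_T - z_C}{2} + \dfrac{\Lambda e L}{2(\lambda-\mu)(e+L)},\; z_T - z_C - \dfrac{\Lambda e L}{\mu(e+L)} \right\}, & \text{if } z_T - z_C \geq \dfrac{\Lambda e L}{(\lambda-\mu)(e+L)}, \\[2mm] z_T - z_C, & \text{if } 0 \leq z_T - z_C < \dfrac{\Lambda e L}{(\lambda-\mu)(e+L)}. \end{cases}$$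
   Context: Bottleneck model with outside option. A continuum of users of total mass $\Lambda>0$ has desired bottleneck crossing times $t^*$ uniformly distributed over $[t_1,t_2]$, with desired arrival rate $\lambda = \Lambda/(t_2-t_1)$. Each user travels either by car, through a deterministic first-in-first-out point-queue bottleneck with capacity (maximal service rate) $\mu>0$, or by public transit. All costs are normalized by the value of waiting time. A car user with desired crossing time $t^*$ who crosses the bottleneck at time $t$ pays $$c(t,t^* ) = z_C + w(t) + e\,(t^*-t)_+ + L\,(t-t^* )_+ + \tau(t),$$ where $z_C$ is the free-flow cost of a car trip, $w(t)\ge 0$ is the (endogenous) queuing delay of a vehicle crossing at time $t$ ($w(t)>0$ only when the bottleneck discharges at capacity), $0<e<1$ and $L>0$ are the earliness and lateness penalties, and $\tau(t)\ge 0$ is the toll. A transit user pays the fixed cost $z_T$ and arrives at the desired time. A toll is static if $\tau(t)=\tau$ for all $t$. Equilibrium: given the toll, every user chooses a mode and, if traveling by car, a crossing time, so as to minimize own cost given $w(\cdot)$, and no user has an incentive to deviate; car users cross in order of their desired crossing times. When users are indifferent between car and transit, ties are broken in favor of higher-revenue outcomes. When $z_T \ge z_C$ and $\mu<\lambda$, car users cross at rate $\mu$ over an equilibrium interval $[t_A,t_D]$. Revenue: $R(\tau)$ is the total toll paid by car users at the equilibrium induced by the toll; for a static toll $R(\tau) = \tau(\Lambda - N_T(\tau))$, where $N_T(\tau)$ is the mass of transit users at the equilibrium under $\tau$. *)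

(* Defs.v *)
(* MathComp-Analysis, over an arbitrary realType. *)
From HB Require Import structures.
From mathcomp Require Import all_boot all_order all_algebra.
From mathcomp Require Import all_classical all_reals all_analysis.

Set Implicit Arguments.
Unset Strict Implicit.
Unset Printing Implicit Defensive.

Import Order.TTheory GRing.Theory Num.Theory.

Local Open Scope classical_set_scope.
Local Open Scope ring_scope.

Record bottleneck (R : realType) := Bottleneck {
  total_mass : R;
  t_first : R;
  t_last : R;
  capacity : R;
  earliness : R;
  lateness : R;
  car_cost : R;
  transit_cost : R;
  total_mass_gt0 : 0 < total_mass;
  t_first_lt_last : t_first < t_last;
  capacity_gt0 : 0 < capacity;
  earliness_gt0 : 0 < earliness;
  earliness_lt1 : earliness < 1;
  lateness_gt0 : 0 < lateness
}.

Definition arrival_rate (R : realType) (B : bottleneck R) : R :=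
  total_mass B / (t_last B - t_first B).

(* A user is a pair (t*, i): a desired crossing time t* and an index i in [0, 1]
   telling apart the users who share it.  With population measure
   arrival_rate * (Lebesgue x Lebesgue), t* is uniform on [t_first, t_last] and
   the total mass is total_mass; the index lets any proportion of the users
   with nearby desired times take a given mode. *)
Definition user (R : realType) : Type :=
  (measurableTypeR R * measurableTypeR R)%type.

Definition desired_time (R : realType) (u : user R) : R := u.1.

Definition users (R : realType) (B : bottleneck R) : set (user R) :=
  `[t_first B, t_last B]%classic `*` `[0, 1]%classic.

Definition mass (R : realType) (B : bottleneck R) (A : set (user R)) : R :=
  arrival_rate B *
  fine ((@lebesgue_measure R \x @lebesgue_measure R)%E A).

(* The value of crossing_time at a transit user is irrelevant.  delay t is the
   queuing delay of a vehicle that crosses at time t (hence that joined the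
   queue at time t - delay t). *)
Record outcome (R : realType) := Outcome {
  car_users : set (user R);
  crossing_time : user R -> R;
  delay : R -> R
}.

Definition car_trip_cost (R : realType) (B : bottleneck R) (toll w : R -> R)
    (t tstar : R) : R :=
  car_cost B + w t + earliness B * Num.max 0 (tstar - t)
  + lateness B * Num.max 0 (t - tstar) + toll t.

Definition crossed_by (R : realType) (B : bottleneck R) (x : outcome R)
    (t : R) : R :=
  mass B [set u | car_users x u /\ crossing_time x u <= t].

(* fifo says that entry times into the queue are ordered as crossing times. *)
Record feasible (R : realType) (B : bottleneck R) (x : outcome R) : Prop :=
  Feasible {
  car_users_sub : car_users x `<=` users B;
  car_users_measurable : measurable (car_users x);
  crossing_time_measurable :
    measurable_fun (car_users x)
      (crossing_time x : user R -> measurableTypeR R);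
  delay_ge0 : forall t, 0 <= delay x t;
  fifo : forall s t, s <= t -> s - delay x s <= t - delay x t;
  within_capacity : forall s t, s <= t ->
    crossed_by B x t - crossed_by B x s <= capacity B * (t - s);
  queue_discharges_at_capacity : forall s t, s <= t ->
    (forall r, s < r < t -> 0 < delay x r) ->
    crossed_by B x t - crossed_by B x s = capacity B * (t - s)
}.

Record equilibrium (R : realType) (B : bottleneck R) (toll : R -> R)
    (x : outcome R) : Prop := Equilibrium {
  equilibrium_feasible : feasible B x;
  crossing_in_desired_order : forall u v, car_users x u -> car_users x v ->
    desired_time u < desired_time v -> crossing_time x u <= crossing_time x v;
  car_users_best_time : forall u, car_users x u -> forall t,
    car_trip_cost B toll (delay x) (crossing_time x u) (desired_time u)
      <= car_trip_cost B toll (delay x) t (desired_time u);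
  car_users_best_mode : forall u, car_users x u ->
    car_trip_cost B toll (delay x) (crossing_time x u) (desired_time u)
      <= transit_cost B;
  transit_users_best_mode : forall u, users B u -> ~ car_users x u -> forall t,
    transit_cost B <= car_trip_cost B toll (delay x) t (desired_time u)
}.

Definition static_toll (R : realType) (tau : R) : R -> R := fun=> tau.

Definition transit_mass (R : realType) (B : bottleneck R) (x : outcome R) : R :=
  mass B (users B `\` car_users x).

Definition outcome_revenue (R : realType) (B : bottleneck R) (tau : R)
    (x : outcome R) : R :=
  tau * (total_mass B - transit_mass B x).

(* Ties between modes are broken in favor of revenue: the revenue of a toll is
   the largest one over the equilibria it admits. *)
Definition revenue (R : realType) (B : bottleneck R) (tau : R) : R :=
  sup [set outcome_revenue B tau x
      | x in [set x | equilibrium B (static_toll tau) x]].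

(* The second clause requires the supremum at tau to be the revenue of an
   actual equilibrium. *)
Definition revenue_optimal_static_toll (R : realType) (B : bottleneck R)
    (tau : R) : Prop :=
  [/\ 0 <= tau,
      exists2 x, equilibrium B (static_toll tau) x
               & outcome_revenue B tau x = revenue B tau
    & forall tau', 0 <= tau' -> revenue B tau' <= revenue B tau].

(* Main.v *)
Require Import Defs.
From mathcomp Require Import all_boot all_order all_algebra.
From mathcomp Require Import all_classical all_reals all_analysis.
From mathcomp Require Import measurable_realfun.
From mathcomp Require Import ring lra.

Set Implicit Arguments.
Unset Strict Implicit.
Unset Printing Implicit Defensive.

Import Order.TTheory GRing.Theory Num.Theory.

Local Open Scope ring_scope.

(* Let s = zT - zC - tau be the surplus left to car users.  Indifference to
   transit forces the delay to be at least s at the desired times of transit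
   users, and car users pay at most s; so if transit users have desired times
   spanning [a, b], car users with desired times in ]a, b[ cross in [a, b], and
   those outside cross in [a - s/e, b + s/L].  Capacity then bounds the car mass
   by (mu / lambda) (Lambda + (lambda - mu) s (1/e + 1/L)), besides Lambda.  The
   trapezoidal delay with plateau s attains the first bound as long as it is at
   most Lambda, and tau times the smaller of the two bounds is maximal exactly at
   the stated toll: a concave parabola cut by the line tau * Lambda. *)

(** The delicate point is the bound a - s/e. A car user crossing at T with desired time d pays at
    least e (d - T), which controls T only relative to d, and d may lie well before a; moreover no
    continuity of the delay is assumed. What helps is crowding: everyone with a desired time before
    a drives and crosses by a, and since lambda > mu, at each earlier time someone crosses ahead of
    schedule. The optimality of these users forces the delay to grow at rate e from the start of the
    queue up to a. The extremal equilibrium is dictated by the upper bound. For a window [a, b] the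
    car mass is at most mu (b - a + s/e + s/L), which increases with b - a, and at most Lambda -
    (lambda - mu) (b - a), which decreases. Both are tight together only when lambda (b - a) =
    Lambda - mu (s/e + s/L), everyone outside the window drives, a share mu / lambda drives inside
    it, and capacity is used during the whole crossing period. *)

(** * Trip cost net of free-flow cost and toll, and the bound on early crossings *)

Definition queue_cost (R : realType) (e L : R) (w : R -> R) (t y : R) : R :=
  w t + e * Num.max 0 (y - t) + L * Num.max 0 (t - y).

Lemma queue_cost_early (R : realType) (e L : R) (w : R -> R) (t y : R) :
  t <= y -> queue_cost e L w t y = w t + e * (y - t).
Proof.
move=> ty; rewrite /queue_cost max_r ?subr_ge0// max_l ?subr_le0//.
by rewrite mulr0 addr0.
Qed.

Lemma queue_cost_late (R : realType) (e L : R) (w : R -> R) (t y : R) :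
  y <= t -> queue_cost e L w t y = w t + L * (t - y).
Proof.
move=> yt; rewrite /queue_cost max_l ?subr_le0// max_r ?subr_ge0//.
by rewrite mulr0 addr0.
Qed.

(** Reversing time exchanges earliness and lateness, so late crossings reduce to early ones. *)
Lemma queue_cost_opp (R : realType) (e L : R) (w : R -> R) (t y : R) :
  queue_cost L e (fun x => w (- x)) (- t) (- y) = queue_cost e L w t y.
Proof.
by rewrite /queue_cost opprK !opprK [- y + t]addrC [- t + y]addrC addrAC.
Qed.

(* Abstract in the users, times and delay, so that reversing time turns it into
   the bound on late crossings.  With t0 the last zero of w before a, no user
   crosses before t0; since lambda > mu, at each time th < a some user crossing
   by th wishes to cross later than th by a fixed fraction of a - th, and this
   user's optimality propagates w t >= e (t - t0) past th, up to a.  The users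
   wishing to cross just before a then pay e (a - t0). *)
Lemma early_crossing_bound (R : realType) (U : Type) (car : U -> Prop)
    (d T : U -> R) (w : R -> R) (e L s lambda mu t1 a : R) :
  0 < e -> 0 < L -> 0 < mu -> mu < lambda -> t1 <= a ->
  (forall t, 0 <= w t) ->
  (forall t, exists2 z, z < t & w z = 0) ->
  (forall p q, p < q -> (forall r, p < r < q -> 0 < w r) ->
    exists2 u, car u & p < T u < q) ->
  (forall p q r r', t1 <= p -> p < q -> q <= a ->
    (forall u, car u -> p < d u < q -> r <= T u <= r') ->
    lambda * (q - p) <= mu * (r' - r)) ->
  (forall u, car u -> t1 <= d u) ->
  (forall u t, car u ->
    queue_cost e L w (T u) (d u) <= queue_cost e L w t (d u)) ->
  (forall u, car u -> queue_cost e L w (T u) (d u) <= s) ->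
  (forall u, car u -> d u < a -> T u <= a) ->
  forall u, car u -> e * (a - T u) <= s.
Proof.
move=> e0 L0 mu0 mulam t1a w0 zeros served room dge best cheap before.
have lam0 : 0 < lambda by exact: lt_trans mulam.
have after z u : car u -> w z = 0 -> z < d u -> z <= T u.
  move=> cu wz zd; rewrite leNgt; apply/negP => Tz.
  have := best u z cu.
  rewrite !queue_cost_early ?wz; [|exact: ltW|exact: ltW (lt_trans Tz zd)].
  have := w0 (T u); have : 0 < e * (z - T u) by rewrite mulr_gt0 ?subr_gt0.
  lra.
(* With [a = t1] every desired time is at least [a], and the user's own cost already gives the
   bound. *)
have [a_t1|t1_lt_a] := leP a t1.
  move=> u cu; have := cheap u cu; have du := dge u cu.
  have [Td|dT] := leP (T u) (d u).
    rewrite queue_cost_early//; have := w0 (T u).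
    have : 0 <= e * (d u - a) by rewrite mulr_ge0 ?subr_ge0 ?(ltW e0)// (le_trans a_t1).
    lra.
  rewrite queue_cost_late ?(ltW dT)//; have := w0 (T u).
  have : 0 <= e * (T u - a) by rewrite mulr_ge0 ?subr_ge0 ?(ltW e0)//; lra.
  have : 0 <= L * (T u - d u) by rewrite mulr_ge0 ?subr_ge0 ?(ltW L0) ?(ltW dT).
  lra.
(* If the delay vanished at some [z] in [t1, a[, all users with desired times in ]z, a[ would cross
   within [z, a], too many for the capacity. *)
have zero_lt z : z < a -> w z = 0 -> z < t1.
  move=> za wz; rewrite ltNge; apply/negP => t1z.
  have : lambda * (a - z) <= mu * (a - z).
    apply: room => // u cu /andP[zd da]; rewrite before// andbT.
    exact: after.
  have : 0 < a - z by rewrite subr_gt0.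
  by move=> az; rewrite ler_pM2r// leNgt mulam.
pose Z := [set z | z < a /\ w z = 0]%classic.
have Z0 : (Z !=set0)%classic by have [z za wz] := zeros a; exists z.
have Zub : ubound Z t1 by move=> z [za wz]; exact/ltW/zero_lt.
have hsZ : has_sup Z by split => //; exists t1.
pose t0 := sup Z.
have t0t1 : t0 <= t1 by apply: ge_sup.
have Tge u : car u -> t0 <= T u.
  move=> cu; apply: ge_sup => // z [za wz].
  by apply: after => //; exact: lt_le_trans (zero_lt _ za wz) (dge _ cu).
have wpos r : t0 < r -> r < a -> 0 < w r.
  move=> t0r ra; rewrite lt_neqAle w0 andbT; apply/eqP => wr.
  have : r <= t0 by apply: ub_le_sup; [exists t1 | split].
  by rewrite leNgt t0r.
have t0a : t0 < a by exact: le_lt_trans t1_lt_a.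
(* The delay is positive right after [t0], so some user crosses within [eps / e] of [t0]; this user
   pays at least e (d - t0) - eps, and crossing at [t] is no cheaper. *)
have base t : t <= t1 -> - (e * t0) <= w t - e * t.
  move=> tt1; apply/ler_addgt0Pr => eps eps0.
  have [u cu /andP[t0T Tu]] : exists2 u, car u & t0 < T u < Num.min a (t0 + eps / e).
    apply: served; first by rewrite lt_min t0a ltrDl divr_gt0.
    by move=> r /andP[t0r]; rewrite lt_min => /andP[ra _]; exact: wpos.
  have {Tu}[Ta Teps] : T u < a /\ T u < t0 + eps / e.
    by move: Tu; rewrite lt_min => /andP.
  have eT : e * T u <= e * t0 + eps.
    have : e * T u <= e * (t0 + eps / e) by rewrite ler_pM2l// ltW.
    by rewrite mulrDr mulrCA divff ?gt_eqF// mulr1.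
  have td : t <= d u by exact: le_trans tt1 (dge _ cu).
  have := best u t cu; rewrite (queue_cost_early _ _ _ td).
  have wT := w0 (T u).
  have [Td|dT] := leP (T u) (d u); first by rewrite queue_cost_early//; lra.
  rewrite queue_cost_late ?(ltW dT)//.
  have : 0 <= L * (T u - d u) by rewrite mulr_ge0 ?subr_ge0 ?(ltW L0) ?(ltW dT).
  have : e * d u <= e * T u by rewrite ler_pM2l// ltW.
  lra.
(* Chosen so that lambda (1 - k) is the midpoint of mu and lambda: the users with desired times in
   ]th + k (a - th), a[ are then too many to cross all within [th, a]. *)
pose k := (lambda - mu) / (2 * lambda).
have k0 : 0 < k by rewrite divr_gt0 ?subr_gt0 ?mulr_gt0.
have ahead th : t1 <= th -> th < a ->
    exists2 u, car u & th + k * (a - th) < d u /\ T u <= th.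
  move=> t1th tha; apply: contrapT => no.
  have ath : 0 < a - th by rewrite subr_gt0.
  have kp : 0 < k * (a - th) by rewrite mulr_gt0.
  have k1 : lambda * (1 - k) > mu.
    have -> : lambda * (1 - k) = (lambda + mu) / 2 by rewrite /k; field; rewrite gt_eqF.
    lra.
  have k_lt1 : k < 1.
    by rewrite /k ltr_pdivrMr ?mulr_gt0//; lra.
  have : lambda * (a - (th + k * (a - th))) <= mu * (a - th).
    apply: room => //; [lra | nra |].
    move=> u cu /andP[du da]; rewrite before// andbT leNgt; apply/negP => Tth.
    by apply: no; exists u => //; split => //; exact: ltW.
  have -> : a - (th + k * (a - th)) = (1 - k) * (a - th) by ring.
  by rewrite mulrA ler_pM2r// leNgt k1.
(* Induction along the real line: the strict [t < y] lets the property pass to the supremum [th], so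
   it remains to push beyond any [th < a]. *)
pose H := [set y | y <= a /\ forall t, t < y -> - (e * t0) <= w t - e * t]%classic.
have Ht1 : H t1 by split => // t /ltW; exact: base.
have hsH : has_sup H by split; [exists t1 | exists a => y []].
pose th := sup H.
have t1th : t1 <= th by apply: ub_le_sup => //; exact: hsH.2.
have tha : th <= a by apply: ge_sup; [exists t1 | move=> y []].
have gth t : t < th -> - (e * t0) <= w t - e * t.
  by move=> /(sup_gt hsH.1)[y [_ Hy] ty]; exact: Hy.
have tha' : th = a.
  apply/eqP; rewrite eq_le tha /= leNgt; apply/negP => {}tha.
  have kath : 0 < k * (a - th) by rewrite mulr_gt0 ?subr_gt0.
  (* Stepping back by half of the gain k (a - th) reaches times where the bound is known, while the
     user supplied by [ahead] still has a desired time beyond [th]. The maximum with [t1] covers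
     [th] close to [t1], where [base] applies. *)
  pose y := Num.max t1 (th - k * (a - th) / 2).
  have t1y : t1 <= y by rewrite le_max lexx.
  have yth : y <= th by rewrite ge_max t1th; lra.
  have gy t : t <= y -> - (e * t0) <= w t - e * t.
    rewrite le_max => /orP[|tth]; first exact: base.
    by apply: gth; lra.
  have [u cu [du Tu]] := ahead y t1y (le_lt_trans yth tha).
  have {}du : th < d u.
    apply: lt_trans du.
    have : th - k * (a - th) / 2 <= y by rewrite le_max lexx orbT.
    have : k * (a - th) <= k * (a - y) by rewrite ler_pM2l// lerB.
    lra.
  have : H (Num.min a (d u)).
    split => [|t]; first by rewrite ge_min lexx.
    rewrite lt_min => /andP[_ /ltW td].
    have := best u t cu; rewrite !queue_cost_early//.
      by have := gy _ Tu; lra.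
    by rewrite (le_trans Tu)// (le_trans yth)// ltW.
  move/(ub_le_sup hsH.2); rewrite -/th leNgt lt_min tha => /negP; exact.
have key : e * (a - t0) <= s.
  apply/ler_addgt0Pr => eps eps0.
  pose y := Num.max t1 (a - eps / e).
  have ya : y < a by rewrite gt_max t1_lt_a ltrBlDr ltrDl divr_gt0.
  have [|u cu [du Tu]] := ahead y _ ya; first by rewrite le_max lexx.
  have {}du : y < d u.
    by rewrite (lt_trans _ du)// ltrDl mulr_gt0 ?subr_gt0.
  have := cheap u cu; rewrite queue_cost_early; last by rewrite (le_trans Tu) ?ltW.
  have : - (e * t0) <= w (T u) - e * T u.
    by apply: gth; rewrite tha'; exact: le_lt_trans ya.
  have : e * (a - eps / e) <= e * d u.
    by rewrite ler_pM2l// (le_trans _ (ltW du))// le_max lexx orbT.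
  rewrite mulrBr (mulrC e (eps / e)) divfK ?gt_eqF//.
  lra.
move=> u cu; apply: le_trans key.
by rewrite ler_pM2l// lerB// Tge.
Qed.

(** * Masses of sets of users *)

Lemma arrival_rate_gt0 (R : realType) (B : bottleneck R) : 0 < arrival_rate B.
Proof.
by rewrite divr_gt0 ?total_mass_gt0// subr_gt0 t_first_lt_last.
Qed.

Lemma total_massE (R : realType) (B : bottleneck R) :
  total_mass B = arrival_rate B * (t_last B - t_first B).
Proof. by rewrite divfK// subr_eq0 gt_eqF// t_first_lt_last. Qed.

Lemma measurable_rectangle (R : realType) (i j : interval R) :
  measurable ([set` i] `*` [set` j] : set (user R))%classic.
Proof. by apply: measurableX; exact: measurable_itv. Qed.

Lemma measurable_users (R : realType) (B : bottleneck R) :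
  measurable (users B).
Proof. exact: measurable_rectangle. Qed.

Lemma measurable_desired_time (R : realType) (D : set (user R)) :
  measurable D ->
  measurable_fun D (@desired_time R : user R -> measurableTypeR R).
Proof. by move=> mD; exact: measurable_funS measurable_fst. Qed.

Lemma lebesgue_measure_bounded_itv (R : realType) (b c : bool) (p q : R) :
  p <= q ->
  @lebesgue_measure R [set` Interval (BSide b p) (BSide c q)]%classic =
  (q - p)%:E.
Proof.
move=> pq; rewrite lebesgue_measure_itv/= lte_fin.
have [_|qp] := ltP p q; first by rewrite EFinB.
have -> : q = p by apply: le_anti; rewrite qp.
by rewrite subrr.
Qed.

Lemma rectangle_measure (R : realType) (b c : bool) (p q h : R) :
  p <= q -> 0 <= h ->
  (@lebesgue_measure R \x @lebesgue_measure R)%E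
    ([set` Interval (BSide b p) (BSide c q)] `*` `[0, h])%classic =
  ((q - p) * h)%:E.
Proof.
move=> pq h0; rewrite product_measure1E; try exact: measurable_itv.
rewrite [X in (X * _)%E]lebesgue_measure_bounded_itv//.
by rewrite [X in (_ * X)%E]lebesgue_measure_bounded_itv// subr0.
Qed.

Lemma mass_rectangle (R : realType) (B : bottleneck R) (b c : bool) (p q h : R) :
  p <= q -> 0 <= h ->
  mass B ([set` Interval (BSide b p) (BSide c q)] `*` `[0, h])%classic =
  arrival_rate B * ((q - p) * h).
Proof. by move=> pq h0; rewrite /mass rectangle_measure. Qed.

Lemma mass_users (R : realType) (B : bottleneck R) :
  mass B (users B) = total_mass B.
Proof.
rewrite mass_rectangle//; last exact/ltW/t_first_lt_last.
by rewrite mulr1 -total_massE.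
Qed.

Lemma users_finite (R : realType) (B : bottleneck R) :
  ((@lebesgue_measure R \x @lebesgue_measure R) (users B) < +oo)%E.
Proof.
rewrite rectangle_measure ?ltry//; exact/ltW/t_first_lt_last.
Qed.

Lemma sub_users_fin_num (R : realType) (B : bottleneck R) (A : set (user R)) :
  measurable A -> (A `<=` users B)%classic ->
  (@lebesgue_measure R \x @lebesgue_measure R)%E A \is a fin_num.
Proof.
move=> mA AB; rewrite ge0_fin_numE//.
apply: le_lt_trans (users_finite B).
by apply: le_measure => //; rewrite inE//; exact: measurable_users.
Qed.

Lemma mass_le (R : realType) (B : bottleneck R) (A C : set (user R)) :
  measurable A -> measurable C -> (A `<=` C)%classic -> (C `<=` users B)%classic ->
  mass B A <= mass B C.
Proof.
move=> mA mC AC CB; rewrite ler_pM2l ?arrival_rate_gt0//.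
have fA := sub_users_fin_num mA (subset_trans AC CB).
have fC := sub_users_fin_num mC CB.
by apply: fine_le => //; apply: le_measure => //; rewrite inE.
Qed.

Lemma massU (R : realType) (B : bottleneck R) (A C : set (user R)) :
  measurable A -> measurable C -> (A `<=` users B)%classic ->
  (C `<=` users B)%classic -> [disjoint A & C]%classic ->
  mass B (A `|` C)%classic = mass B A + mass B C.
Proof.
move=> mA mC AB CB /disj_set2P AC; rewrite /mass measureU// fineD ?mulrDr//.
  exact: sub_users_fin_num AB.
exact: sub_users_fin_num CB.
Qed.

Lemma massD (R : realType) (B : bottleneck R) (A C : set (user R)) :
  measurable A -> measurable C -> (C `<=` users B)%classic ->
  (A `<=` C)%classic -> mass B (C `\` A)%classic = mass B C - mass B A.
Proof.
move=> mA mC CB AC.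
have AB := subset_trans AC CB.
have mD : measurable (C `\` A)%classic by exact: measurableD.
rewrite -{2}(setDUK AC) massU//; first by rewrite addrAC subrr add0r.
  by move=> u [/CB].
by apply/disj_set2P; rewrite setDIK.
Qed.

Lemma outcome_revenueE (R : realType) (B : bottleneck R) (tau : R)
    (x : outcome R) :
  (car_users x `<=` users B)%classic -> measurable (car_users x) ->
  outcome_revenue B tau x = tau * mass B (car_users x).
Proof.
move=> xB mx; rewrite /outcome_revenue /transit_mass massD//.
  by rewrite mass_users opprB addrC subrK.
exact: measurable_users.
Qed.

(** * Consequences of capacity and discharge *)

Lemma measurable_crossing_in (R : realType) (B : bottleneck R) (x : outcome R)
    (i : interval R) :
  feasible B x ->
  measurable (car_users x `&` crossing_time x @^-1` [set` i])%classic.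
Proof.
move=> fx; have := crossing_time_measurable fx (car_users_measurable fx).
by apply; exact: measurable_itv.
Qed.

Lemma measurable_crossed_by (R : realType) (B : bottleneck R) (x : outcome R)
    (t : R) :
  feasible B x ->
  measurable [set u | car_users x u /\ crossing_time x u <= t]%classic.
Proof.
move=> fx; have := measurable_crossing_in `]-oo, t] fx.
by congr measurable; apply/seteqP; split => u /=; rewrite in_itv.
Qed.

Lemma measurable_crossing_between (R : realType) (B : bottleneck R)
    (x : outcome R) (s t : R) :
  feasible B x ->
  measurable [set u | car_users x u /\ s < crossing_time x u <= t]%classic.
Proof.
move=> fx; have := measurable_crossing_in `]s, t] fx.
by congr measurable; apply/seteqP; split => u /=; rewrite in_itv.
Qed.

Lemma crossed_between (R : realType) (B : bottleneck R) (x : outcome R)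
    (s t : R) :
  feasible B x -> s <= t ->
  mass B [set u | car_users x u /\ s < crossing_time x u <= t]%classic =
  crossed_by B x t - crossed_by B x s.
Proof.
move=> fx st; rewrite /crossed_by -massD.
- congr (mass B _); apply/seteqP; split => u /=.
    by move=> [cu /andP[sT Tt]]; split => //; move=> [_]; rewrite leNgt sT.
  move=> [[cu Tt] ns]; split => //; rewrite Tt andbT ltNge; apply/negP => Ts.
  exact: ns (conj cu Ts).
- exact: (measurable_crossed_by _ fx).
- exact: (measurable_crossed_by _ fx).
- by move=> u [/(car_users_sub fx)].
- by move=> u [cu Ts]; split => //; exact: le_trans st.
Qed.

(** The capacity constraint counts crossings in half-open intervals; enlarging to ]r - h, r'] and
    letting [h] tend to 0 includes the crossings at [r] itself. *)
Lemma mass_crossing_within (R : realType) (B : bottleneck R) (x : outcome R)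
    (A : set (user R)) (r r' : R) :
  feasible B x -> measurable A -> (A `<=` car_users x)%classic -> r <= r' ->
  (forall u, A u -> r <= crossing_time x u <= r') ->
  mass B A <= capacity B * (r' - r).
Proof.
move=> fx mA Ax rr' Ar; apply/ler_addgt0Pr => eps eps0.
pose h := eps / capacity B.
have h0 : 0 < h by rewrite divr_gt0 ?capacity_gt0.
have rhr' : r - h <= r' by lra.
have -> : capacity B * (r' - r) + eps = capacity B * (r' - (r - h)).
  by rewrite /h; field; rewrite gt_eqF ?capacity_gt0.
apply: le_trans (within_capacity fx rhr').
rewrite -crossed_between//; apply: mass_le => //.
- exact: (measurable_crossing_between _ _ fx).
- move=> u Au; split; first exact: Ax.
  by have := Ar u Au => /andP[rT ->]; rewrite andbT; lra.
- by move=> u [/(car_users_sub fx)].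
Qed.

Lemma delay_pos_served (R : realType) (B : bottleneck R) (x : outcome R)
    (p q : R) :
  feasible B x -> p < q -> (forall r, p < r < q -> 0 < delay x r) ->
  exists2 u, car_users x u & p < crossing_time x u < q.
Proof.
move=> fx pq wpos; apply: contrapT => no.
pose q' := (p + q) / 2.
have pq' : p < q' by rewrite /q'; lra.
have q'q : q' < q by rewrite /q'; lra.
have : crossed_by B x q' - crossed_by B x p = capacity B * (q' - p).
  apply: (queue_discharges_at_capacity fx) => [|r /andP[pr rq']].
    exact: ltW.
  by apply: wpos; rewrite pr (lt_trans rq').
rewrite -crossed_between ?(ltW pq')//.
have -> : [set u | car_users x u /\ p < crossing_time x u <= q']%classic = set0.
  apply/seteqP; split => u //= [cu /andP[pT Tq']].
  by apply: no; exists u => //; rewrite pT (le_lt_trans Tq').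
rewrite /mass measure0 mulr0 => /esym/eqP; apply/negP.
by rewrite gt_eqF// mulr_gt0 ?capacity_gt0// subr_gt0.
Qed.

Lemma queue_length_bound (R : realType) (B : bottleneck R) (x : outcome R)
    (p q : R) :
  feasible B x -> p <= q -> (forall r, p < r < q -> 0 < delay x r) ->
  capacity B * (q - p) <= total_mass B.
Proof.
move=> fx pq wpos; rewrite -(queue_discharges_at_capacity fx pq wpos).
rewrite -crossed_between// -mass_users; apply: mass_le.
- exact: (measurable_crossing_between _ _ fx).
- exact: measurable_users.
- by move=> u [/(car_users_sub fx)].
- by [].
Qed.

(** A queue lasting longer than Lambda / mu would discharge more than the whole population. *)
Lemma zero_delay_between (R : realType) (B : bottleneck R) (x : outcome R)
    (p q : R) :
  feasible B x -> total_mass B < capacity B * (q - p) ->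
  exists2 z, p < z < q & delay x z = 0.
Proof.
move=> fx pq; apply: contrapT => no.
have p_le_q : p <= q.
  apply/ltW; rewrite -subr_gt0 -(pmulr_rgt0 _ (capacity_gt0 B)).
  exact: lt_trans (total_mass_gt0 B) pq.
have : capacity B * (q - p) <= total_mass B.
  apply: (queue_length_bound fx) => // r pqr.
  rewrite lt_neqAle (delay_ge0 fx) andbT; apply/eqP => wr.
  by apply: no; exists r.
by rewrite leNgt pq.
Qed.

Lemma crowding_bound (R : realType) (B : bottleneck R) (x : outcome R)
    (p q r r' : R) :
  feasible B x -> t_first B <= p -> p < q -> q <= t_last B ->
  (forall u, users B u -> p < desired_time u < q -> car_users x u) ->
  (forall u, car_users x u -> p < desired_time u < q ->
    r <= crossing_time x u <= r') ->
  arrival_rate B * (q - p) <= capacity B * (r' - r).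
Proof.
move=> fx tp pq qt allcar within.
pose A := (`]p, q[ `*` `[0, 1])%classic : set (user R).
have Aint u : A u -> p < desired_time u < q.
  by case: u => d i [/=]; rewrite in_itv/= => pdq _.
have Acar : (A `<=` car_users x)%classic.
  move=> u Au; apply: allcar; last exact: Aint.
  case: u Au => d i [/=]; rewrite !in_itv/= => /andP[pd dq] i01; split => //=.
  by rewrite in_itv/= (le_trans tp (ltW pd)) (le_trans (ltW dq) qt).
have Ar u : A u -> r <= crossing_time x u <= r'.
  by move=> Au; apply: within; [exact: Acar|exact: Aint].
have rr' : r <= r'.
  (* Any user of the strip witnesses [r <= r']. *)
  have : A ((p + q) / 2, 0).
    by split => /=; rewrite in_itv/= ?lexx ?ler01//; apply/andP; split; lra.
  by move=> /Ar/andP[]; exact: le_trans.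
have <- : mass B A = arrival_rate B * (q - p).
  by rewrite mass_rectangle ?mulr1// ltW.
apply: (mass_crossing_within fx) => //.
exact: measurable_rectangle.
Qed.

(** * Costs and crossing times in an arbitrary equilibrium *)

Definition surplus (R : realType) (B : bottleneck R) (tau : R) : R :=
  transit_cost B - car_cost B - tau.

Lemma car_trip_cost_static (R : realType) (B : bottleneck R) (tau : R)
    (w : R -> R) (t y : R) :
  car_trip_cost B (static_toll tau) w t y =
  car_cost B + tau + queue_cost (earliness B) (lateness B) w t y.
Proof. by rewrite /car_trip_cost /static_toll /queue_cost; ring. Qed.

Lemma car_user_best (R : realType) (B : bottleneck R) (tau : R)
    (x : outcome R) (u : user R) (t : R) :
  equilibrium B (static_toll tau) x -> car_users x u ->
  queue_cost (earliness B) (lateness B) (delay x)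
    (crossing_time x u) (desired_time u) <=
  queue_cost (earliness B) (lateness B) (delay x) t (desired_time u).
Proof.
move=> ex cu; have := car_users_best_time ex cu t.
by rewrite !car_trip_cost_static lerD2l.
Qed.

Lemma car_user_cost (R : realType) (B : bottleneck R) (tau : R)
    (x : outcome R) (u : user R) :
  equilibrium B (static_toll tau) x -> car_users x u ->
  queue_cost (earliness B) (lateness B) (delay x)
    (crossing_time x u) (desired_time u) <= surplus B tau.
Proof.
move=> ex cu; have := car_users_best_mode ex cu.
by rewrite car_trip_cost_static /surplus; lra.
Qed.

Lemma transit_user_cost (R : realType) (B : bottleneck R) (tau : R)
    (x : outcome R) (u : user R) (t : R) :
  equilibrium B (static_toll tau) x -> users B u -> ~ car_users x u ->
  surplus B tau <=
  queue_cost (earliness B) (lateness B) (delay x) t (desired_time u).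
Proof.
move=> ex Bu ncu; have := transit_users_best_mode ex Bu ncu t.
by rewrite car_trip_cost_static /surplus; lra.
Qed.

Lemma users_desired (R : realType) (B : bottleneck R) (u : user R) :
  users B u -> t_first B <= desired_time u <= t_last B.
Proof. by case: u => d i [/=]; rewrite in_itv. Qed.

Lemma first_crossing (R : realType) (B : bottleneck R) (tau a : R)
    (x : outcome R) :
  capacity B < arrival_rate B -> equilibrium B (static_toll tau) x ->
  t_first B <= a <= t_last B ->
  (forall u, users B u -> desired_time u < a -> car_users x u) ->
  (forall u, car_users x u -> desired_time u < a -> crossing_time x u <= a) ->
  forall u, car_users x u ->
  earliness B * (a - crossing_time x u) <= surplus B tau.
Proof.
move=> mulam ex /andP[ta at'] allcar before.
have fx := equilibrium_feasible ex.
apply: (@early_crossing_bound R (user R) (car_users x) (@desired_time R)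
  (crossing_time x) (delay x) (earliness B) (lateness B) (surplus B tau)
  (arrival_rate B) (capacity B) (t_first B) a) => //.
- exact: earliness_gt0.
- exact: lateness_gt0.
- exact: capacity_gt0.
- exact: delay_ge0 fx.
- move=> t.
  have [|z /andP[_ zt] wz] := @zero_delay_between R B x
      (t - (total_mass B + 1) / capacity B) t fx; last by exists z.
  rewrite opprB addrC subrK mulrC divfK ?gt_eqF ?capacity_gt0//.
  by rewrite ltrDl ltr01.
- by move=> p q pq wpos; exact: (delay_pos_served fx).
- move=> p q r r' tp pq qa within; apply: (crowding_bound fx) => //.
    exact: le_trans at'.
  by move=> u Bu /andP[_ dq]; apply: allcar => //; exact: lt_le_trans qa.
- by move=> u /(car_users_sub fx)/users_desired/andP[].
- by move=> u t cu; exact: (car_user_best _ ex).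
- by move=> u cu; exact: (car_user_cost ex).
Qed.

(** Time reversal of [first_crossing]: times change sign, [earliness] and [lateness] are exchanged,
    and [t_last] takes the place of [t_first]. *)
Lemma last_crossing (R : realType) (B : bottleneck R) (tau b : R)
    (x : outcome R) :
  capacity B < arrival_rate B -> equilibrium B (static_toll tau) x ->
  t_first B <= b <= t_last B ->
  (forall u, users B u -> b < desired_time u -> car_users x u) ->
  (forall u, car_users x u -> b < desired_time u -> b <= crossing_time x u) ->
  forall u, car_users x u ->
  lateness B * (crossing_time x u - b) <= surplus B tau.
Proof.
move=> mulam ex /andP[tb bt] allcar after u cu.
have fx := equilibrium_feasible ex.
have -> : crossing_time x u - b = - b - - crossing_time x u by ring.
apply: (@early_crossing_bound R (user R) (car_users x)
  (fun u => - desired_time u) (fun u => - crossing_time x u)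
  (fun t => delay x (- t)) (lateness B) (earliness B) (surplus B tau)
  (arrival_rate B) (capacity B) (- t_last B) (- b)) => // {u cu}.
- exact: lateness_gt0.
- exact: earliness_gt0.
- exact: capacity_gt0.
- by rewrite lerN2.
- by move=> t; exact: delay_ge0 fx _.
- move=> t.
  have [|z /andP[tz _] wz] := @zero_delay_between R B x
      (- t) (- t + (total_mass B + 1) / capacity B) fx.
    rewrite addrAC subrr add0r mulrC divfK ?gt_eqF ?capacity_gt0//.
    by rewrite ltrDl ltr01.
  by exists (- z); rewrite ?opprK// ltrNl.
- move=> p q pq wpos.
  have [|r /andP[qr rp]|u cu /andP[qT Tp]] := @delay_pos_served R B x (- q) (- p) fx.
  + by rewrite ltrN2.
  + by rewrite -[r]opprK; apply: wpos; rewrite ltrNr rp ltrNl.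
  + by exists u => //; rewrite ltrNr Tp ltrNl.
- move=> p q r r' tp pq qb within.
  have -> : q - p = - p - - q by ring.
  have -> : r' - r = - r - - r' by ring.
  apply: (crowding_bound fx).
  + by rewrite (le_trans tb)// lerNr.
  + by rewrite ltrN2.
  + by rewrite lerNl.
  + move=> u Bu /andP[qd _]; apply: allcar => //.
    by rewrite (le_lt_trans _ qd)// lerNr.
  + move=> u cu /andP[qd dp]; have := within u cu.
    by rewrite ltrNr dp ltrNl qd => /(_ isT)/andP[rT Tr]; rewrite lerNl Tr lerNr.
- by move=> u /(car_users_sub fx)/users_desired/andP[_]; rewrite lerN2.
- by move=> u t cu; rewrite -[t]opprK !queue_cost_opp; exact: (car_user_best _ ex).
- by move=> u cu; rewrite queue_cost_opp; exact: (car_user_cost ex).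
- by move=> u cu; rewrite ltrN2 lerN2; exact: after.
Qed.

(** If [u] wished to cross before [v] but crossed after the desired time of [v], then [v] could
    cross at that same moment with strictly less lateness than [u], hence for less than the surplus,
    and would not use transit. The other case is symmetric. *)
Lemma crossing_beside_transit (R : realType) (B : bottleneck R) (tau : R)
    (x : outcome R) (u v : user R) :
  equilibrium B (static_toll tau) x -> car_users x u -> users B v ->
  ~ car_users x v ->
  (desired_time u < desired_time v -> crossing_time x u <= desired_time v) /\
  (desired_time v < desired_time u -> desired_time v <= crossing_time x u).
Proof.
move=> ex cu Bv ncv; have := car_user_cost ex cu.
have := transit_user_cost (crossing_time x u) ex Bv ncv.
set T := crossing_time x u; set p := desired_time v; set d := desired_time u.
move=> sp sd; split => dp; rewrite leNgt; apply/negP => pT.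
  have dT := lt_trans dp pT.
  move: sp sd; rewrite !queue_cost_late ?(ltW pT) ?(ltW dT)//.
  have : 0 < lateness B * (p - d) by rewrite mulr_gt0 ?lateness_gt0 ?subr_gt0.
  lra.
have dT := lt_trans pT dp.
move: sp sd; rewrite !queue_cost_early ?(ltW pT) ?(ltW dT)//.
have : 0 < earliness B * (d - p) by rewrite mulr_gt0 ?earliness_gt0 ?subr_gt0.
lra.
Qed.

(** A car user strictly inside the window has transit users on both sides, and their desired times
    enclose the crossing. Extreme transit users need not exist, hence infimum and supremum. *)
Lemma exists_transit_window (R : realType) (B : bottleneck R) (tau : R)
    (x : outcome R) :
  equilibrium B (static_toll tau) x ->
  exists a b, [/\ t_first B <= a, a <= b & b <= t_last B] /\
    [/\ forall u, users B u -> desired_time u < a -> car_users x u,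
        forall u, users B u -> b < desired_time u -> car_users x u,
        forall u, car_users x u -> desired_time u < a -> crossing_time x u <= a,
        forall u, car_users x u -> b < desired_time u -> b <= crossing_time x u
      & forall u, car_users x u -> a < desired_time u < b ->
          a <= crossing_time x u <= b].
Proof.
move=> ex; have fx := equilibrium_feasible ex.
have t12 := ltW (t_first_lt_last B).
pose P := [set @desired_time R u | u in (users B `\` car_users x)]%classic.
have Pbd p : P p -> t_first B <= p <= t_last B.
  by move=> [u [/users_desired ? _] <-].
have Pcross p u : P p -> car_users x u ->
    (desired_time u < p -> crossing_time x u <= p) /\
    (p < desired_time u -> p <= crossing_time x u).
  by move=> [v [Bv ncv] <-] cu; exact: (crossing_beside_transit ex cu Bv ncv).
have Pcar u : users B u -> ~ P (desired_time u) -> car_users x u.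
  by move=> Bu nP; apply: contrapT => ncu; apply: nP; exists u.
have [P0|P0] := pselect (P !=set0)%classic.
  have Pl : has_lbound P by exists (t_first B) => p /Pbd/andP[].
  have Pu : has_ubound P by exists (t_last B) => p /Pbd/andP[].
  have ainf p : P p -> inf P <= p by exact: ge_inf.
  have bsup p : P p -> p <= sup P by exact: ub_le_sup.
  have adh d : inf P < d -> exists2 p, P p & p < d.
    by move=> /(inf_lt P0)[p Pp pd]; exists p.
  have bdh d : d < sup P -> exists2 p, P p & d < p.
    by move=> /(sup_gt P0)[p Pp pd]; exists p.
  exists (inf P), (sup P); split; split.
  - by apply: lb_le_inf => // p /Pbd/andP[].
  - by have [p Pp] := P0; exact: le_trans (ainf _ Pp) (bsup _ Pp).
  - by apply: ge_sup => // p /Pbd/andP[].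
  - by move=> u Bu da; apply: Pcar => // /ainf; rewrite leNgt da.
  - by move=> u Bu db; apply: Pcar => // /bsup; rewrite leNgt db.
  - move=> u cu da; apply: lb_le_inf => // p Pp.
    by apply: (Pcross p u Pp cu).1; exact: lt_le_trans da (ainf _ Pp).
  - move=> u cu db; apply: ge_sup => // p Pp.
    by apply: (Pcross p u Pp cu).2; exact: le_lt_trans (bsup _ Pp) db.
  - move=> u cu /andP[ad db]; have [p Pp pd] := adh _ ad; have [q Pq dq] := bdh _ db.
    rewrite (le_trans (ainf _ Pp) ((Pcross p u Pp cu).2 pd)).
    exact: le_trans ((Pcross q u Pq cu).1 dq) (bsup _ Pq).
have allcar u : users B u -> car_users x u.
  by move=> Bu; apply: Pcar => // Pd; apply: P0; exists (desired_time u).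
(* Without transit users the window is the point where crossing turns from
   early to late. *)
pose E := [set y | y = t_first B \/
  exists u, [/\ car_users x u, crossing_time x u <= desired_time u &
                y = desired_time u]]%classic.
have Et1 : E (t_first B) by left.
have Ebd y : E y -> t_first B <= y <= t_last B.
  case=> [->|[u [/(car_users_sub fx)/users_desired + _ ->]]] //.
  by rewrite lexx.
have Eu : has_ubound E by exists (t_last B) => y /Ebd/andP[].
have E0 : (E !=set0)%classic by exists (t_first B).
have a1 : t_first B <= sup E by exact: ub_le_sup.
have a2 : sup E <= t_last B by apply: ge_sup => // y /Ebd/andP[].
exists (sup E), (sup E); split; split => //.
- by move=> u Bu _; exact: allcar.
- by move=> u Bu _; exact: allcar.
(* Some [v] with a later desired time does not cross late; crossing in desired order carries the
   bound over to [u]. *)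
- move=> u cu /(sup_gt E0)[y Ey dy].
  have := ub_le_sup Eu Ey; case: Ey dy => [->|[v [cv Tv ->]]] dv vE.
    have /users_desired/andP[] := car_users_sub fx cu.
    by rewrite leNgt dv.
  apply: le_trans (crossing_in_desired_order ex cu cv dv) _.
  exact: le_trans Tv vE.
- move=> u cu Ed; rewrite leNgt; apply/negP => TE.
  suff /(ub_le_sup Eu) : E (desired_time u) by rewrite leNgt Ed.
  by right; exists u; split => //; exact: ltW (lt_trans TE Ed).
- by move=> u _ /andP[/lt_trans/[apply]]; rewrite ltxx.
Qed.

(* The crossing window bounds the car mass by mu (b - a + s/e + s/L), the transit
   users by Lambda - (lambda - mu) (b - a); weights lambda - mu and mu eliminate
   b - a. *)
Lemma car_mass_bound (R : realType) (B : bottleneck R) (tau : R)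
    (x : outcome R) :
  capacity B < arrival_rate B -> equilibrium B (static_toll tau) x ->
  0 <= surplus B tau ->
  arrival_rate B * mass B (car_users x) <=
  capacity B * (total_mass B + (arrival_rate B - capacity B) *
    (surplus B tau / earliness B + surplus B tau / lateness B)).
Proof.
move=> mulam ex s0; have fx := equilibrium_feasible ex.
have [a [b [[ta ab bt] [carl carr before after within]]]] :=
  exists_transit_window ex.
set s := surplus B tau.
have e0 := earliness_gt0 B; have L0 := lateness_gt0 B.
have se0 : 0 <= s / earliness B by rewrite divr_ge0// ltW.
have sL0 : 0 <= s / lateness B by rewrite divr_ge0// ltW.
have tat : t_first B <= a <= t_last B by rewrite ta (le_trans ab).
have tbt : t_first B <= b <= t_last B by rewrite bt andbT (le_trans ta).
have N1 : mass B (car_users x) <=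
    capacity B * ((b + s / lateness B) - (a - s / earliness B)).
  apply: (mass_crossing_within fx) => //; first exact: car_users_measurable fx.
    lra.
  move=> u cu; apply/andP; split.
    have := first_crossing mulam ex tat carl before cu.
    by rewrite mulrC -ler_pdivlMr// -/s; lra.
  have := last_crossing mulam ex tbt carr after cu.
  by rewrite mulrC -ler_pdivlMr// -/s; lra.
pose W := (`]a, b[ `*` `[0, 1])%classic : set (user R).
have mW : measurable W by exact: measurable_rectangle.
have mC := car_users_measurable fx.
have CB := car_users_sub fx.
have WB : (W `<=` users B)%classic.
  move=> [d i] [/=]; rewrite !in_itv/= => /andP[ad db] i01; split => //=.
  by rewrite in_itv/= (le_trans ta (ltW ad)) (le_trans (ltW db)).
have massW : mass B W = arrival_rate B * (b - a).
  by rewrite mass_rectangle// mulr1.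
have mB := measurable_users B.
(* Car users of the strip [W] cross within [a, b], which capacity limits; everyone outside [W] is
   counted as driving. *)
have N2 : mass B (car_users x) <=
    capacity B * (b - a) + (total_mass B - arrival_rate B * (b - a)).
  rewrite -massW -mass_users -massD//.
  have mCW : measurable (car_users x `&` W)%classic by exact: measurableI.
  have mBW : measurable (users B `\` W)%classic by exact: measurableD.
  apply: (@le_trans _ _ (mass B ((car_users x `&` W) `|` (users B `\` W))%classic)).
    apply: mass_le => //; first exact: measurableU.
      move=> u cu; have [Wu|nWu] := pselect (W u); first by left.
      by right; split => //; exact: CB.
    by move=> u [[/CB]|[]].
  rewrite massU//.
  - rewrite lerD2r; apply: (mass_crossing_within fx) => // u [cu [du _]].
    by apply: within => //; move: du; rewrite /= in_itv.
  - by move=> u [/CB].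
  - by apply/disj_set2P; apply/seteqP; split => u // [[_ ?] []].
have lm : 0 <= arrival_rate B - capacity B by rewrite subr_ge0 ltW.
have := ler_wpM2l lm N1; have := ler_wpM2l (ltW (capacity_gt0 B)) N2.
lra.
Qed.

(** * The change of time between desired and crossing times *)

(* With k = 1 - lambda / mu this maps desired times to crossing times of the
   constructed equilibrium; with k = 1 - mu / lambda it is the inverse map. *)
Definition stretch (R : realType) (k a b y : R) : R :=
  y + k * (Num.max 0 (a - y) - Num.max 0 (y - b)).

Lemma stretch_le (R : realType) (k a b y : R) :
  y <= a -> a <= b -> stretch k a b y = y + k * (a - y).
Proof.
move=> ya ab; rewrite /stretch max_r ?subr_ge0// max_l ?subr0// subr_le0.
exact: le_trans ab.
Qed.

Lemma stretch_mid (R : realType) (k a b y : R) :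
  a <= y -> y <= b -> stretch k a b y = y.
Proof.
by move=> ay yb; rewrite /stretch !max_l ?subr_le0// subrr mulr0 addr0.
Qed.

Lemma stretch_ge (R : realType) (k a b y : R) :
  b <= y -> a <= b -> stretch k a b y = y - k * (y - b).
Proof.
move=> yb ab; rewrite /stretch max_l ?subr_le0 ?(le_trans ab)//.
by rewrite max_r ?subr_ge0// sub0r mulrN.
Qed.

Lemma le_stretch (R : realType) (k a b : R) :
  k <= 1 -> a <= b -> {homo stretch k a b : x y / x <= y}.
Proof.
move=> k1 ab x y xy.
have E z : z <= a \/ a <= z <= b \/ b <= z.
  have [za|/ltW az] := leP z a; first by left.
  by have [zb|/ltW bz] := leP z b; right; [left; rewrite az|right].
have mono p q : p <= q -> k * (q - p) <= q - p.
  by move=> pq; rewrite ler_piMl ?subr_ge0.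
have [xa|[/andP[ax xb]|bx]] := E x; have [ya|[/andP[ay yb]|b_y]] := E y;
  rewrite ?(stretch_le _ xa ab) ?(stretch_le _ ya ab) ?(stretch_mid _ ax xb)
    ?(stretch_mid _ ay yb) ?(stretch_ge _ bx ab) ?(stretch_ge _ b_y ab).
- by have := mono _ _ xy; lra.
- by have := mono _ _ xa; lra.
- by have := mono _ _ xa; have := mono _ _ b_y; lra.
- have -> : y = a by lra.
  by rewrite subrr mulr0; lra.
- by [].
- by have := mono _ _ b_y; lra.
- have -> : x = b by lra.
  have -> : y = a by lra.
  by rewrite !subrr !mulr0; lra.
- have -> : x = b by lra.
  by rewrite subrr mulr0; lra.
- by have := mono _ _ xy; lra.
Qed.

(** Outside [a, b] the two maps are dilations about the nearer endpoint, with ratios 1/r and r. *)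
Lemma stretchK (R : realType) (r a b : R) :
  0 < r -> a <= b -> cancel (stretch (1 - r^-1) a b) (stretch (1 - r) a b).
Proof.
move=> r0 ab y; have ri : 0 < r^-1 by rewrite invr_gt0.
have [ya|ay] := leP y a.
  rewrite [stretch (1 - r^-1) _ _ _]stretch_le//.
  rewrite stretch_le//; first by field; rewrite gt_eqF.
  have -> : y + (1 - r^-1) * (a - y) = a - r^-1 * (a - y) by ring.
  by rewrite gerBl mulr_ge0 ?subr_ge0// ltW.
have [yb|b_y] := leP y b.
  by rewrite [stretch (1 - r^-1) _ _ _]stretch_mid ?(ltW ay)// stretch_mid ?(ltW ay).
rewrite [stretch (1 - r^-1) _ _ _]stretch_ge ?(ltW b_y)//.
rewrite stretch_ge//; first by field; rewrite gt_eqF.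
have -> : y - (1 - r^-1) * (y - b) = b + r^-1 * (y - b) by ring.
by rewrite lerDl mulr_ge0 ?subr_ge0// ltW.
Qed.

(** Turns the users who have crossed by a given time into those with desired times below a
    threshold, whose mass is explicit. *)
Lemma stretch_leE (R : realType) (r a b x y : R) :
  0 < r -> a <= b ->
  (stretch (1 - r^-1) a b x <= y) = (x <= stretch (1 - r) a b y).
Proof.
move=> r0 ab; have ri : 0 < r^-1 by rewrite invr_gt0.
have K := stretchK ri ab; rewrite invrK in K.
apply/idP/idP => [h|h].
  by rewrite -[x](stretchK r0 ab); apply: le_stretch => //; lra.
by rewrite -[y]K; apply: le_stretch => //; lra.
Qed.

(** * The extremal equilibrium with a trapezoidal delay *)

(** The share of users driving inside the window: they then arrive at rate mu and can all cross at
    their desired times. *)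
Definition car_share (R : realType) (B : bottleneck R) : R :=
  capacity B / arrival_rate B.

(** The users desiring a time before it have mass mu s/e, which is what the bottleneck serves while
    the delay climbs from 0 to s at slope e. [window_end] is built likewise with slope L. *)
Definition window_start (R : realType) (B : bottleneck R) (s : R) : R :=
  t_first B + car_share B * (s / earliness B).

Definition window_end (R : realType) (B : bottleneck R) (s : R) : R :=
  t_last B - car_share B * (s / lateness B).

Definition window_cars (R : realType) (B : bottleneck R) (s : R) :
    set (user R) :=
  (`[t_first B, window_start B s] `*` `[0, 1] `|`
   `]window_start B s, window_end B s] `*` `[0, car_share B] `|`
   `]window_end B s, t_last B] `*` `[0, 1])%classic.

(** The trapezoid before clipping at 0. As a function of the desired time it is also the users'
    least cost of driving, net of free-flow cost and toll. *)
Definition window_delay (R : realType) (B : bottleneck R) (s t : R) : R :=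
  s - earliness B * Num.max 0 (window_start B s - t)
    - lateness B * Num.max 0 (t - window_end B s).

Definition window_outcome (R : realType) (B : bottleneck R) (s : R) :
    outcome R :=
  Outcome (window_cars B s)
    (fun u => stretch (1 - (car_share B)^-1)
                (window_start B s) (window_end B s) (desired_time u))
    (fun t => Num.max 0 (window_delay B s t)).

Lemma car_share_gt0 (R : realType) (B : bottleneck R) : 0 < car_share B.
Proof. by rewrite divr_gt0 ?capacity_gt0 ?arrival_rate_gt0. Qed.

Lemma car_shareK (R : realType) (B : bottleneck R) :
  arrival_rate B * car_share B = capacity B.
Proof. by rewrite mulrC divfK// gt_eqF ?arrival_rate_gt0. Qed.

Lemma mass_interval (R : realType) (B : bottleneck R) (b c : bool) (p q h : R) :
  0 <= h ->
  mass B ([set` Interval (BSide b p) (BSide c q)] `*` `[0, h])%classic =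
  arrival_rate B * (Num.max 0 (q - p) * h).
Proof.
move=> h0; have [pq|qp] := leP p q; first by rewrite mass_rectangle// max_r ?subr_ge0.
rewrite max_l ?subr_le0 ?(ltW qp)// mul0r mulr0 set_itv_ge; last first.
  by case: b c => [] []; rewrite bnd_simp -?leNgt -?ltNge// ltW.
by rewrite set0X /mass measure0 mulr0.
Qed.

Lemma car_share_lt1 (R : realType) (B : bottleneck R) :
  capacity B < arrival_rate B -> car_share B < 1.
Proof. by rewrite ltr_pdivrMr ?arrival_rate_gt0// mul1r. Qed.

(** The length b - a of the window satisfies lambda (b - a) = Lambda - mu (s/e + s/L), so the
    hypothesis says that the window is not reversed. *)
Lemma window_ordered (R : realType) (B : bottleneck R) (s : R) :
  0 <= s -> capacity B * (s / earliness B + s / lateness B) <= total_mass B ->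
  [/\ t_first B <= window_start B s, window_start B s <= window_end B s
    & window_end B s <= t_last B].
Proof.
move=> s0 sL.
have r0 := ltW (car_share_gt0 B).
have se0 : 0 <= s / earliness B by rewrite divr_ge0// ltW ?earliness_gt0.
have sL0 : 0 <= s / lateness B by rewrite divr_ge0// ltW ?lateness_gt0.
split; [by rewrite lerDl mulr_ge0| |by rewrite gerBl mulr_ge0].
rewrite -subr_ge0 -(pmulr_rge0 _ (arrival_rate_gt0 B)).
have -> : arrival_rate B * (window_end B s - window_start B s) =
    total_mass B - arrival_rate B * car_share B *
      (s / earliness B + s / lateness B).
  by rewrite total_massE /window_end /window_start; ring.
by rewrite car_shareK subr_ge0.
Qed.

Lemma mass_window_cars_le (R : realType) (B : bottleneck R) (s y : R) :
  capacity B < arrival_rate B -> 0 <= s ->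
  capacity B * (s / earliness B + s / lateness B) <= total_mass B ->
  mass B [set u | window_cars B s u /\ desired_time u <= y]%classic =
  arrival_rate B * Num.max 0 (Num.min (window_start B s) y - t_first B) +
  capacity B * Num.max 0 (Num.min (window_end B s) y - window_start B s) +
  arrival_rate B * Num.max 0 (Num.min (t_last B) y - window_end B s).
Proof.
move=> mulam s0 sL; have [ta ab bt] := window_ordered s0 sL.
move: ta ab bt; rewrite /window_cars.
set a := window_start B s; set b := window_end B s => ta ab bt.
have r0 := ltW (car_share_gt0 B); have r1 := ltW (car_share_lt1 mulam).
pose A1 := (`[t_first B, Num.min a y] `*` `[0, 1])%classic : set (user R).
pose A2 := (`]a, Num.min b y] `*` `[0, car_share B])%classic : set (user R).
pose A3 := (`]b, Num.min (t_last B) y] `*` `[0, 1])%classic : set (user R).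
have mA1 : measurable A1 by exact: measurable_rectangle.
have mA2 : measurable A2 by exact: measurable_rectangle.
have mA3 : measurable A3 by exact: measurable_rectangle.
rewrite (_ : mkset _ = (A1 `|` A2 `|` A3)%classic); last first.
  apply/seteqP; split => -[d i]; rewrite /A1 /A2 /A3 /desired_time/= !in_itv/= !le_min.
    by move=> [[[[h ?]|[h ?]]|[h ?]] dy]; [left; left|left; right|right];
      rewrite dy andbT.
  by move=> [[[/[!andbA]/andP[h dy] ?]|[/[!andbA]/andP[h dy] ?]]|
      [/[!andbA]/andP[h dy] ?]]; split => //; [left; left|left; right|right].
have usersI d i : t_first B <= d <= t_last B -> 0 <= i <= 1 -> users B (d, i).
  by move=> hd hi; split; rewrite /= in_itv.
have A1B : (A1 `<=` users B)%classic.
  move=> [d i] [/=]; rewrite !in_itv/= le_min => /and3P[td da _] hi.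
  by apply: usersI => //; rewrite td (le_trans da) ?(le_trans ab).
have A2B : (A2 `<=` users B)%classic.
  move=> [d i] [/=]; rewrite !in_itv/= le_min => /and3P[ad db _] /andP[i0 i1].
  apply: usersI; last by rewrite i0 (le_trans i1).
  by rewrite (le_trans ta (ltW ad)) (le_trans db).
have A3B : (A3 `<=` users B)%classic.
  move=> [d i] [/=]; rewrite !in_itv/= le_min => /and3P[bd dt _] hi.
  by apply: usersI => //; rewrite dt (le_trans ta) ?(le_trans ab (ltW bd)).
rewrite massU//; first last.
- apply/disj_set2P; apply/seteqP; split => // -[d i].
  rewrite /A1 /A2 /A3/= !in_itv/= !le_min => -[] [[/and3P[_ da _] _]|[/and3P[_ db _] _]].
    by move=> [/andP[/(le_lt_trans (le_trans da ab))]]; rewrite ltxx.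
  by move=> [/andP[/(le_lt_trans db)]]; rewrite ltxx.
- by move=> u [/A1B|/A2B].
- exact: measurableU.
rewrite massU//; last first.
  apply/disj_set2P; apply/seteqP; split => // -[d i].
  rewrite /A1 /A2/= !in_itv/= !le_min => -[] [/and3P[_ da _] _].
  by move=> [/andP[/(le_lt_trans da)]]; rewrite ltxx.
rewrite !mass_interval// !mulr1.
by rewrite [_ * car_share B]mulrC mulrA car_shareK.
Qed.

(** Outside the window all users drive, with density lambda, and stretching time by lambda / mu
    thins them to rate mu; inside, the share mu / lambda gives rate mu directly. The crossing period
    is thus served at capacity throughout. *)
Lemma window_crossed_by (R : realType) (B : bottleneck R) (s t : R) :
  capacity B < arrival_rate B -> 0 <= s ->
  capacity B * (s / earliness B + s / lateness B) <= total_mass B ->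
  crossed_by B (window_outcome B s) t =
  capacity B * Num.max 0 (Num.min t (window_end B s + s / lateness B) -
                          (window_start B s - s / earliness B)).
Proof.
move=> mulam s0 sL; have [ta ab bt] := window_ordered s0 sL.
have r0 := car_share_gt0 B; have r1 := car_share_lt1 mulam.
rewrite /crossed_by (_ : mkset _ = [set u | window_cars B s u /\
    desired_time u <= stretch (1 - car_share B) (window_start B s)
      (window_end B s) t]%classic); last first.
  by apply/seteqP; split => u /=; rewrite stretch_leE.
rewrite mass_window_cars_le//.
have se0 : 0 <= s / earliness B by rewrite divr_ge0// ltW ?earliness_gt0.
have sL0 : 0 <= s / lateness B by rewrite divr_ge0// ltW ?lateness_gt0.
have ea : window_start B s - t_first B = car_share B * (s / earliness B).
  by rewrite /window_start; ring.
have eb : t_last B - window_end B s = car_share B * (s / lateness B).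
  by rewrite /window_end; ring.
move: ta ab bt ea eb se0 sL0 (car_shareK B) r0 r1.
set a := window_start B s; set b := window_end B s.
set al := s / earliness B; set be := s / lateness B.
set r := car_share B; set lam := arrival_rate B; set mu := capacity B.
set t1 := t_first B; set t2 := t_last B.
move=> ta ab bt ea eb al0 be0 lr r0 r1.
have scale z : lam * Num.max 0 (r * z) = mu * Num.max 0 z.
  by rewrite -{1}(mulr0 r) -maxr_pMr ?(ltW r0)// mulrA lr.
have [ta'|at'] := leP t a.
  rewrite stretch_le//.
  have -> : t + (1 - r) * (a - t) = a - r * (a - t) by ring.
  have ra : 0 <= r * (a - t) by rewrite mulr_ge0 ?subr_ge0// ltW.
  rewrite [Num.min a _]min_r; last lra.
  rewrite [Num.min b _]min_r; last lra.
  rewrite [Num.min t2 _]min_r; last lra.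
  rewrite [Num.min t _]min_l; last lra.
  rewrite [Num.max 0 (_ - a)]max_l; last lra.
  rewrite [Num.max 0 (_ - b)]max_l; last lra.
  rewrite !mulr0 !addr0 -scale; congr (_ * Num.max _ _).
  have -> : a - r * (a - t) - t1 = (a - t1) - r * (a - t) by ring.
  by rewrite ea; ring.
have aY : lam * Num.max 0 (a - t1) = mu * al.
  by rewrite ea scale max_r.
have [tb|b_t] := leP t b.
  rewrite stretch_mid ?(ltW at')//.
  rewrite [Num.min a _]min_l ?(ltW at')// aY.
  rewrite [Num.min b _]min_r//.
  rewrite [Num.min t2 _]min_r; last lra.
  rewrite [Num.min t _]min_l; last lra.
  rewrite [Num.max 0 (_ - a)]max_r; last lra.
  rewrite [Num.max 0 (_ - b)]max_l; last lra.
  rewrite max_r; last lra.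
  by ring.
rewrite stretch_ge ?(ltW b_t)//.
have -> : t - (1 - r) * (t - b) = b + r * (t - b) by ring.
have rb : 0 <= r * (t - b) by rewrite mulr_ge0 ?subr_ge0// ltW.
rewrite [Num.min a _]min_l ?aY; last lra.
rewrite [Num.min b _]min_l; last lra.
rewrite [Num.max 0 (_ - a)]max_r; last lra.
have -> : Num.min t2 (b + r * (t - b)) - b = r * Num.min be (t - b).
  rewrite minr_pMr ?(ltW r0)// -eb addr_minl.
  by congr (Num.min _ _); ring.
rewrite scale max_r; last by rewrite le_min be0; lra.
have -> : Num.min t (b + be) = b + Num.min be (t - b).
  by rewrite addr_minr minC; congr (Num.min _ _); ring.
have : 0 <= Num.min be (t - b) by rewrite le_min be0; lra.
by move=> m0; rewrite max_r; [ring|lra].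
Qed.

Lemma measurable_window_cars (R : realType) (B : bottleneck R) (s : R) :
  measurable (window_cars B s).
Proof.
by apply: measurableU; [apply: measurableU|]; exact: measurable_rectangle.
Qed.

Lemma window_cars_sub (R : realType) (B : bottleneck R) (s : R) :
  capacity B < arrival_rate B -> 0 <= s ->
  capacity B * (s / earliness B + s / lateness B) <= total_mass B ->
  (window_cars B s `<=` users B)%classic.
Proof.
move=> mulam s0 sL [d i]; have [ta ab bt] := window_ordered s0 sL.
have r1 := ltW (car_share_lt1 mulam).
rewrite /window_cars/users/= !in_itv/=.
move=> [[[/andP[td da] i01]|[/andP[ad db] /andP[i0 ir]]]|[/andP[bd dt] i01]].
- by rewrite td (le_trans da) ?(le_trans ab).
- by rewrite (le_trans ta (ltW ad)) (le_trans db)// i0 (le_trans ir).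
- by rewrite dt (le_trans ta (le_trans ab (ltW bd))).
Qed.

Lemma transit_in_window (R : realType) (B : bottleneck R) (s : R) (u : user R) :
  users B u -> ~ window_cars B s u ->
  window_start B s <= desired_time u <= window_end B s.
Proof.
case: u => d i; rewrite /window_cars/users/desired_time/= !in_itv/=.
move=> [/andP[td dt] i01] n; apply/andP; split; rewrite leNgt; apply/negP => h.
  by apply: n; left; left; rewrite td (ltW h).
by apply: n; right; rewrite h dt.
Qed.

(** The bound of [car_mass_bound], attained. *)
Lemma window_cars_mass (R : realType) (B : bottleneck R) (s : R) :
  capacity B < arrival_rate B -> 0 <= s ->
  capacity B * (s / earliness B + s / lateness B) <= total_mass B ->
  arrival_rate B * mass B (window_cars B s) =
  capacity B * (total_mass B + (arrival_rate B - capacity B) *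
    (s / earliness B + s / lateness B)).
Proof.
move=> mulam s0 sL; have [ta ab bt] := window_ordered s0 sL.
have -> : window_cars B s =
    [set u | window_cars B s u /\ desired_time u <= t_last B]%classic.
  apply/seteqP; split => u => [wu|[]//]; split=> //.
  by have /users_desired/andP[] := window_cars_sub mulam s0 sL wu.
rewrite mass_window_cars_le// min_l ?(le_trans ab)// min_l// minxx.
rewrite !max_r ?subr_ge0// total_massE /window_end /window_start.
by rewrite -(car_shareK B); ring.
Qed.

(** This is the [fifo] condition: the delay climbs at slope e, and e < 1. *)
Lemma window_delay_lipschitz (R : realType) (B : bottleneck R) (s p q : R) :
  p <= q ->
  Num.max 0 (window_delay B s q) <= Num.max 0 (window_delay B s p) + (q - p).
Proof.
move=> pq; rewrite /window_delay.
set a := window_start B s; set b := window_end B s.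
have mA : Num.max 0 (a - p) <= Num.max 0 (a - q) + (q - p).
  by rewrite ge_max; apply/andP; split; have [] := leP 0 (a - q); lra.
have mB : Num.max 0 (p - b) <= Num.max 0 (q - b).
  by rewrite ge_max le_max lexx /= le_max; apply/orP; right; lra.
have := ler_wpM2l (ltW (earliness_gt0 B)) mA.
have := ler_wpM2l (ltW (lateness_gt0 B)) mB.
have : earliness B * (q - p) <= q - p.
  by rewrite ler_piMl ?subr_ge0// ltW ?earliness_lt1.
set v := s - _ - _; set v' := s - _ - _ => h1 h2 h3.
have v0 : 0 <= Num.max 0 v' by rewrite le_max lexx.
have v1 : v' <= Num.max 0 v' by rewrite le_max lexx orbT.
by rewrite ge_max; apply/andP; split; rewrite /v /v' in v0 v1 *; lra.
Qed.

Lemma window_delay_pos (R : realType) (B : bottleneck R) (s t : R) :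
  0 < Num.max 0 (window_delay B s t) ->
  window_start B s - s / earliness B < t < window_end B s + s / lateness B.
Proof.
rewrite lt_max ltxx /= /window_delay => h.
have e0 := earliness_gt0 B; have L0 := lateness_gt0 B.
set a := window_start B s in h *; set b := window_end B s in h *.
have A0 : 0 <= earliness B * Num.max 0 (a - t).
  by rewrite mulr_ge0 ?(ltW e0)// le_max lexx.
have B0 : 0 <= lateness B * Num.max 0 (t - b).
  by rewrite mulr_ge0 ?(ltW L0)// le_max lexx.
have A1 : earliness B * (a - t) <= earliness B * Num.max 0 (a - t).
  by rewrite ler_pM2l// le_max lexx orbT.
have B1 : lateness B * (t - b) <= lateness B * Num.max 0 (t - b).
  by rewrite ler_pM2l// le_max lexx orbT.
have : a - t < s / earliness B by rewrite ltr_pdivlMr//; lra.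
have : t - b < s / lateness B by rewrite ltr_pdivlMr//; lra.
lra.
Qed.

(** The trapezoid drops by at most e per unit of time moved earlier and by at most L per unit moved
    later, so leaving the desired time saves no more delay than it costs in penalty; clipping at 0
    only raises the delay. *)
Lemma queue_cost_window_ge (R : realType) (B : bottleneck R) (s t y : R) :
  window_delay B s y <= queue_cost (earliness B) (lateness B)
    (fun t => Num.max 0 (window_delay B s t)) t y.
Proof.
rewrite /queue_cost.
have vt : window_delay B s t <= Num.max 0 (window_delay B s t).
  by rewrite le_max lexx orbT.
have sub (p q r : R) : Num.max 0 (p - r) <= Num.max 0 (q - r) + Num.max 0 (p - q).
  have h1 : 0 <= Num.max 0 (q - r) by rewrite le_max lexx.
  have h2 : 0 <= Num.max 0 (p - q) by rewrite le_max lexx.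
  have h3 : q - r <= Num.max 0 (q - r) by rewrite le_max lexx orbT.
  have h4 : p - q <= Num.max 0 (p - q) by rewrite le_max lexx orbT.
  by rewrite ge_max; apply/andP; split; lra.
apply: le_trans (lerD (lerD vt (lexx _)) (lexx _)).
have := ler_wpM2l (ltW (earliness_gt0 B)) (sub (window_start B s) y t).
have := ler_wpM2l (ltW (lateness_gt0 B)) (sub t y (window_end B s)).
rewrite /window_delay; lra.
Qed.

Lemma window_feasible (R : realType) (B : bottleneck R) (s : R) :
  capacity B < arrival_rate B -> 0 <= s ->
  capacity B * (s / earliness B + s / lateness B) <= total_mass B ->
  feasible B (window_outcome B s).
Proof.
move=> mulam s0 sL; have [ta ab bt] := window_ordered s0 sL.
have mu0 := capacity_gt0 B.
have se0 : 0 <= s / earliness B by rewrite divr_ge0// ltW ?earliness_gt0.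
have sL0 : 0 <= s / lateness B by rewrite divr_ge0// ltW ?lateness_gt0.
split.
- exact: window_cars_sub.
- exact: measurable_window_cars.
- have mstretch : measurable_fun setT
      (stretch (1 - (car_share B)^-1) (window_start B s) (window_end B s)).
    apply: nondecreasing_measurable => //; apply: le_stretch => //.
    by rewrite gerBl invr_ge0 ltW ?car_share_gt0.
  exact: measurableT_comp mstretch
    (measurable_desired_time (measurable_window_cars B s)).
- by move=> t; rewrite le_max lexx.
- by move=> p q /(window_delay_lipschitz B s) /=; lra.
- move=> p q pq; rewrite !window_crossed_by// -mulrBr ler_pM2l//.
  set A := window_start B s - _; set D := window_end B s + _.
  rewrite lerBlDr ge_max; apply/andP; split.
    have : 0 <= Num.max 0 (Num.min p D - A) by rewrite le_max lexx.
    lra.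
  have h : Num.min p D - A <= Num.max 0 (Num.min p D - A).
    by rewrite le_max lexx orbT.
  have : Num.min q D <= Num.min p D + (q - p).
    by have [] := leP p D; rewrite ge_min => ?; apply/orP; [left|right]; lra.
  lra.
(* Positive delay on ]p, q[ places this interval inside the crossing period [A, D], where the
   crossed mass has slope mu. Otherwise a midpoint outside [A, D] would have positive delay. *)
- move=> p q pq wpos; rewrite !window_crossed_by// -mulrBr; congr (_ * _).
  move: pq; rewrite le_eqVlt => /predU1P[->|pq]; first by rewrite !subrr.
  have sup r : p < r < q -> window_start B s - s / earliness B < r <
      window_end B s + s / lateness B.
    by move=> /wpos /window_delay_pos.
  move: sup.
  set A := window_start B s - _; set D := window_end B s + _ => sup.
  have Ap : A <= p.
    rewrite leNgt; apply/negP => pA.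
    have /sup : p < (p + Num.min q A) / 2 < q.
      have : p < Num.min q A by rewrite lt_min pq.
      have : Num.min q A <= q by rewrite ge_min lexx.
      lra.
    have : Num.min q A <= A by rewrite ge_min lexx orbT.
    lra.
  have qD : q <= D.
    rewrite leNgt; apply/negP => Dq.
    have /sup : p < (q + Num.max p D) / 2 < q.
      have : Num.max p D < q by rewrite gt_max pq.
      have : p <= Num.max p D by rewrite le_max lexx.
      lra.
    have : D <= Num.max p D by rewrite le_max lexx orbT.
    lra.
  rewrite [Num.min q D]min_l// [Num.min p D]min_l; last lra.
  rewrite !max_r; lra.
Qed.

(** Equality in [queue_cost_window_ge]: the assigned crossing time lies on the same side or plateau
    of the trapezoid as the desired time, where delay and penalty compensate exactly. *)
Lemma window_car_cost (R : realType) (B : bottleneck R) (s d : R) :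
  capacity B < arrival_rate B -> 0 <= s ->
  capacity B * (s / earliness B + s / lateness B) <= total_mass B ->
  t_first B <= d <= t_last B ->
  queue_cost (earliness B) (lateness B)
    (fun t => Num.max 0 (window_delay B s t))
    (stretch (1 - (car_share B)^-1) (window_start B s) (window_end B s) d) d =
  window_delay B s d.
Proof.
move=> mulam s0 sL /andP[td dt]; have [ta ab bt] := window_ordered s0 sL.
have e0 := earliness_gt0 B; have L0 := lateness_gt0 B.
have r0 := car_share_gt0 B; have r1 := car_share_lt1 mulam.
have ea : window_start B s - t_first B = car_share B * (s / earliness B).
  by rewrite /window_start; ring.
have eb : t_last B - window_end B s = car_share B * (s / lateness B).
  by rewrite /window_end; ring.
move: ta ab bt ea eb; rewrite /window_delay.
set a := window_start B s; set b := window_end B s => ta ab bt ea eb.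
have ri1 : 1 <= (car_share B)^-1 by rewrite invf_ge1 ?ltW.
set r := car_share B in r0 r1 ea eb ri1 *.
have [da|ad] := leP d a.
  rewrite stretch_le//.
  have -> : d + (1 - r^-1) * (a - d) = a - r^-1 * (a - d) by ring.
  have ad0 : 0 <= a - d by rewrite subr_ge0.
  have h1 : 0 <= (r^-1 - 1) * (a - d) by rewrite mulr_ge0 ?subr_ge0.
  (* As [d] is at least [t_first], the crossing time is at least a - s/e, where the trapezoid is
     still nonnegative and clipping changes nothing. *)
  have h2 : r^-1 * (a - d) <= s / earliness B.
    by rewrite mulrC ler_pdivrMr// mulrC -ea lerB.
  have h3 : earliness B * (r^-1 * (a - d)) <= s.
    by move: h2; rewrite ler_pdivlMr// mulrC.
  have h4 : 0 <= r^-1 * (a - d) by rewrite mulr_ge0// (le_trans ler01).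
  rewrite queue_cost_early; last lra.
  rewrite [Num.max 0 (a - (a - _))]max_r; last lra.
  rewrite [Num.max 0 (_ - b)]max_l; last lra.
  rewrite [Num.max 0 (a - d)]max_r//.
  rewrite [Num.max 0 (d - b)]max_l; last lra.
  rewrite max_r; first by ring.
  by have -> : a - (a - r^-1 * (a - d)) = r^-1 * (a - d); [ring|lra].
have [db|bd] := leP d b.
  rewrite stretch_mid ?(ltW ad)// queue_cost_early//.
  rewrite [Num.max 0 (a - d)]max_l; last lra.
  rewrite [Num.max 0 (d - b)]max_l; last lra.
  by rewrite !mulr0 !subr0 max_r// subrr mulr0 addr0.
rewrite stretch_ge ?(ltW bd)//.
have -> : d - (1 - r^-1) * (d - b) = b + r^-1 * (d - b) by ring.
have bd0 : 0 <= d - b by rewrite subr_ge0 ltW.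
have h1 : 0 <= (r^-1 - 1) * (d - b) by rewrite mulr_ge0 // subr_ge0.
have h2 : r^-1 * (d - b) <= s / lateness B.
  by rewrite mulrC ler_pdivrMr// mulrC -eb lerB.
have h3 : lateness B * (r^-1 * (d - b)) <= s.
  by move: h2; rewrite ler_pdivlMr// mulrC.
have h4 : 0 <= r^-1 * (d - b) by rewrite mulr_ge0// (le_trans ler01).
rewrite queue_cost_late; last lra.
rewrite [Num.max 0 (a - (b + _))]max_l; last lra.
rewrite [Num.max 0 (b + _ - b)]max_r; last lra.
rewrite [Num.max 0 (a - d)]max_l; last lra.
rewrite [Num.max 0 (d - b)]max_r//.
rewrite max_r; first by ring.
by have -> : b + r^-1 * (d - b) - b = r^-1 * (d - b); [ring|lra].
Qed.

(** The least cost of driving is [window_delay] at the desired time: at most s everywhere, and equal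
    to s on the window, which contains the desired times of all transit users. *)
Lemma window_equilibrium (R : realType) (B : bottleneck R) (tau : R) :
  let s := surplus B tau in
  capacity B < arrival_rate B -> 0 <= s ->
  capacity B * (s / earliness B + s / lateness B) <= total_mass B ->
  equilibrium B (static_toll tau) (window_outcome B s).
Proof.
move=> s mulam s0 sL.
have [ta ab bt] := window_ordered s0 sL.
have fx := window_feasible mulam s0 sL.
have own u : window_cars B s u ->
    car_trip_cost B (static_toll tau) (delay (window_outcome B s))
      (crossing_time (window_outcome B s) u) (desired_time u) =
    car_cost B + tau + window_delay B s (desired_time u).
  move=> cu; rewrite car_trip_cost_static window_car_cost//.
  exact/users_desired/(window_cars_sub mulam s0 sL).
split => //.
- move=> u v _ _ /ltW; apply: le_stretch => //.
  by rewrite gerBl invr_ge0 ltW ?car_share_gt0.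
- move=> u cu t; rewrite own// car_trip_cost_static lerD2l.
  exact: queue_cost_window_ge.
- move=> u cu; rewrite own// /window_delay.
  set p := Num.max 0 _; set q := Num.max 0 _.
  have p0 : 0 <= earliness B * p.
    by rewrite mulr_ge0 ?(ltW (earliness_gt0 B))// le_max lexx.
  have q0 : 0 <= lateness B * q.
    by rewrite mulr_ge0 ?(ltW (lateness_gt0 B))// le_max lexx.
  rewrite /s /surplus; lra.
- move=> u Bu ncu t; have /andP[au ub] := transit_in_window Bu ncu.
  rewrite car_trip_cost_static.
  have := queue_cost_window_ge B s t (desired_time u).
  rewrite {1}/window_delay !max_l ?subr_le0// !mulr0 !subr0.
  rewrite {1}/s /surplus /=; lra.
Qed.

(** * Revenue as a supremum, and the scalar maximization *)

(** The assumption [0 <= V] covers a toll without equilibrium, since the supremum of the empty set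
    is 0. *)
Lemma revenue_le (R : realType) (B : bottleneck R) (tau V : R) :
  0 <= V ->
  (forall x, equilibrium B (static_toll tau) x -> outcome_revenue B tau x <= V) ->
  revenue B tau <= V.
Proof.
move=> V0 le_V; rewrite /revenue; set E := (X in sup X).
have [E0|/nonemptyPn E0] := pselect (E !=set0)%classic; last by rewrite E0 sup0.
by apply: ge_sup => // _ [x ex <-]; exact: le_V.
Qed.

Lemma revenue_max (R : realType) (B : bottleneck R) (tau : R) (x : outcome R) :
  equilibrium B (static_toll tau) x ->
  (forall y, equilibrium B (static_toll tau) y ->
    outcome_revenue B tau y <= outcome_revenue B tau x) ->
  revenue B tau = outcome_revenue B tau x.
Proof.
move=> ex le_x; apply: le_anti; apply/andP; split.
  by apply: ge_sup => [|_ [y ey <-]]; [exists (outcome_revenue B tau x), x|exact: le_x].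
apply: ub_le_sup; last by exists x.
by exists (outcome_revenue B tau x) => _ [y ey <-]; exact: le_x.
Qed.

(* D is zT - zC, K and M are Lambda e L / ((lambda - mu) (e + L)) and
   Lambda e L / (mu (e + L)); everyone drives once the surplus reaches M. *)
Definition best_toll (R : realType) (K M D : R) : R :=
  if K <= D then Num.max ((D + K) / 2) (D - M) else D.

Lemma best_toll_bounds (R : realType) (K M D : R) :
  0 < K -> 0 < M -> 0 <= D ->
  [/\ 0 <= best_toll K M D, 0 <= D - best_toll K M D
    & D - best_toll K M D <= M].
Proof.
move=> K0 M0 D0; rewrite /best_toll; case: ifPn => [KD|_].
  have [h|h] := leP ((D + K) / 2) (D - M); split; lra.
by split; lra.
Qed.

Lemma best_toll_gt0 (R : realType) (K M D : R) :
  0 < K -> 0 < D -> 0 < best_toll K M D.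
Proof.
move=> K0 D0; rewrite /best_toll; case: ifPn => // KD.
by rewrite lt_max; apply/orP; left; lra.
Qed.

(** The left side is a line up to D - M and then a parabola with vertex (D + K) / 2. For K > D the
    vertex lies beyond D and the maximum is at D; otherwise it is at the vertex or at the kink D -
    M, whichever is larger. *)
Lemma best_toll_max (R : realType) (K M D t : R) :
  0 < K -> 0 < M -> 0 <= t <= D -> t != best_toll K M D ->
  t * (K + Num.min M (D - t)) < best_toll K M D * (K + (D - best_toll K M D)).
Proof.
move=> K0 M0 /andP[t0 tD]; rewrite /best_toll.
have minM : t * (K + Num.min M (D - t)) <= t * (K + M).
  by rewrite ler_wpM2l// lerD2l ge_min lexx.
have minD : t * (K + Num.min M (D - t)) <= t * (K + (D - t)).
  by rewrite ler_wpM2l// lerD2l ge_min lexx orbT.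
case: ifPn => [KD|]; last first.
  rewrite -ltNge => DK tnD; apply: le_lt_trans minD _.
  have tD' : t < D by rewrite lt_neqAle tnD.
  (* This product is the value of the parabola at [D] minus its value at [t]. *)
  have : 0 < (D - t) * (K - t) by rewrite mulr_gt0// subr_gt0// (lt_trans tD').
  lra.
have [h|h] := leP ((D + K) / 2) (D - M) => tn.
  have [tM|Mt] := leP t (D - M).
    apply: le_lt_trans minM _; rewrite subKr ltr_pM2r ?addr_gt0//.
    by rewrite lt_neqAle tn.
  apply: le_lt_trans minD _.
  have : 0 < (t - (D - M)) * (t + (D - M) - (D + K)).
    by apply: mulr_gt0; lra.
  lra.
apply: le_lt_trans minD _.
have : 0 < (t - (D + K) / 2) ^+ 2.
  by rewrite exprn_even_gt0//= subr_eq0.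
by rewrite expr2; lra.
Qed.

Theorem proposition2 (R : realType) (B : bottleneck R)
    (capacity_lt_rate : capacity B < arrival_rate B)
    (car_le_transit : car_cost B <= transit_cost B) :
  let Lambda := total_mass B in
  let lambda := arrival_rate B in
  let mu := capacity B in
  let e := earliness B in
  let L := lateness B in
  let zC := car_cost B in
  let zT := transit_cost B in
  let tau_opt :=
    if Lambda * e * L / ((lambda - mu) * (e + L)) <= zT - zC then
      Num.max
        ((zT - zC) / 2 + Lambda * e * L / (2 * (lambda - mu) * (e + L)))
        (zT - zC - Lambda * e * L / (mu * (e + L)))
    else zT - zC in
  revenue_optimal_static_toll B tau_opt /\
  (zC < zT -> forall tau, revenue_optimal_static_toll B tau -> tau = tau_opt).
Proof.
move=> Lambda lambda mu e L zC zT tau_opt.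
have [Lam0 e0 L0 mu0] : [/\ 0 < Lambda, 0 < e, 0 < L & 0 < mu].
  split; [exact: total_mass_gt0|exact: earliness_gt0|exact: lateness_gt0|].
  exact: capacity_gt0.
have lm0 : 0 < lambda - mu by rewrite subr_gt0.
have lam0 : 0 < lambda by exact: arrival_rate_gt0.
have eL0 : 0 < e + L by rewrite addr_gt0.
pose D := zT - zC.
pose K := Lambda * e * L / ((lambda - mu) * (e + L)).
pose M := Lambda * e * L / (mu * (e + L)).
(* The slope in s of the bound on the car mass: that bound becomes c (K + s), and Lambda is c (K +
   M), so revenue is at most c tau (K + min(M, D - tau)). *)
pose c := mu * (lambda - mu) * (e + L) / (lambda * e * L).
have D0 : 0 <= D by rewrite subr_ge0.
have K0 : 0 < K by apply: divr_gt0; rewrite !mulr_gt0.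
have M0 : 0 < M by apply: divr_gt0; rewrite !mulr_gt0.
have c0 : 0 < c by apply: divr_gt0; apply: mulr_gt0 => //; apply: mulr_gt0.
have [enz Lnz munz] : [/\ e != 0, L != 0 & mu != 0] by rewrite !gt_eqF.
have [lamnz lmnz eLnz] : [/\ lambda != 0, lambda - mu != 0 & e + L != 0].
  by rewrite !gt_eqF.
have optE : tau_opt = best_toll K M D.
  rewrite /tau_opt /best_toll -/D -/K -/M.
  have -> // : D / 2 + Lambda * e * L / (2 * (lambda - mu) * (e + L)) = (D + K) / 2.
  by rewrite /K; field; rewrite lmnz eLnz.
have carsE s : mu * (Lambda + (lambda - mu) * (s / e + s / L)) / lambda = c * (K + s).
  by rewrite /c /K; field; rewrite enz Lnz lamnz lmnz eLnz.
have LambdaE : Lambda = c * (K + M).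
  by rewrite /c /K /M; field; rewrite enz Lnz lamnz lmnz eLnz munz.
have [opt0 sopt0 soptM] := best_toll_bounds K0 M0 D0.
rewrite optE; set opt := best_toll K M D in opt0 sopt0 soptM *.
pose V := c * (opt * (K + (D - opt))).
have V0 : 0 <= V.
  apply: mulr_ge0; first exact: ltW.
  by apply: mulr_ge0 => //; apply: addr_ge0 => //; exact: ltW.
have bound tau x : 0 <= tau -> tau <= D -> equilibrium B (static_toll tau) x ->
    outcome_revenue B tau x <= c * (tau * (K + Num.min M (D - tau))).
  move=> tau0 tauD ex; have fx := equilibrium_feasible ex.
  rewrite (outcome_revenueE _ (car_users_sub fx) (car_users_measurable fx)).
  rewrite [c * _]mulrCA ler_wpM2l// addr_minr minr_pMr ?(ltW c0)// le_min.
  rewrite -LambdaE -carsE; apply/andP; split.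
    rewrite /Lambda -mass_users; apply: mass_le => //.
    - exact: car_users_measurable fx.
    - exact: measurable_users.
    - exact: car_users_sub fx.
  rewrite ler_pdivlMr// [mass _ _ * _]mulrC.
  have s0 : 0 <= surplus B tau by rewrite /surplus subr_ge0.
  exact: car_mass_bound capacity_lt_rate ex s0.
have no_cars tau x : D < tau -> equilibrium B (static_toll tau) x ->
    outcome_revenue B tau x = 0.
  move=> Dtau ex; have fx := equilibrium_feasible ex.
  rewrite (outcome_revenueE _ (car_users_sub fx) (car_users_measurable fx)).
  suff -> : car_users x = set0 by rewrite /mass measure0 mulr0 mulr0.
  rewrite -subset0 => u cu; have := car_user_cost ex cu.
  apply/negP; rewrite -ltNge; apply: (@lt_le_trans _ _ 0).
    by rewrite /surplus subr_lt0.
  apply: addr_ge0; first apply: addr_ge0; first exact: delay_ge0 fx _.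
    by apply: mulr_ge0; [exact: ltW|rewrite le_max lexx].
  by apply: mulr_ge0; [exact: ltW|rewrite le_max lexx].
have le_V tau x : 0 <= tau -> equilibrium B (static_toll tau) x ->
    outcome_revenue B tau x <= V.
  move=> tau0 ex; have [tauD|Dtau] := leP tau D; last by rewrite (no_cars _ _ Dtau ex).
  apply: le_trans (bound _ _ tau0 tauD ex) _; rewrite ler_pM2l//.
  have [->|ne] := eqVneq tau opt; first by rewrite min_r.
  by apply/ltW/best_toll_max => //; rewrite tau0.
(* Positive [D] makes [V] positive, which strictly excludes the tolls above [D], where revenue is
   0. *)
have lt_V tau x : 0 < D -> 0 <= tau -> equilibrium B (static_toll tau) x ->
    tau != opt -> outcome_revenue B tau x < V.
  move=> Dgt0 tau0 ex ne; have [tauD|Dtau] := leP tau D.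
    apply: le_lt_trans (bound _ _ tau0 tauD ex) _; rewrite ltr_pM2l//.
    by apply: best_toll_max => //; rewrite tau0.
  rewrite (no_cars _ _ Dtau ex) /V; apply: mulr_gt0 => //.
  by apply: mulr_gt0; [exact: best_toll_gt0|exact: ltr_pwDl].
have eqE : surplus B opt = D - opt by [].
(* [M] is the surplus at which the window shrinks to a point, and [D - opt] is at most [M]. *)
have room : capacity B * (surplus B opt / earliness B + surplus B opt / lateness B)
    <= total_mass B.
  rewrite eqE -/mu -/e -/L -/Lambda.
  have -> : mu * ((D - opt) / e + (D - opt) / L) =
      (D - opt) * (mu * (e + L) / (e * L)) by field; rewrite enz Lnz.
  have -> : Lambda = M * (mu * (e + L) / (e * L)).
    by rewrite /M; field; rewrite enz Lnz eLnz munz.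
  by rewrite ler_wpM2r// divr_ge0 ?mulr_ge0// ltW.
pose x0 := window_outcome B (surplus B opt).
have ex0 : equilibrium B (static_toll opt) x0 by exact: window_equilibrium.
have rev0 : outcome_revenue B opt x0 = V.
  have fx := equilibrium_feasible ex0.
  rewrite (outcome_revenueE _ (car_users_sub fx) (car_users_measurable fx)).
  rewrite /V [c * _]mulrCA; congr (_ * _); rewrite -carsE.
  apply: (mulfI lamnz); rewrite [RHS]mulrC divfK//.
  exact: window_cars_mass.
have revopt : revenue B opt = V.
  by rewrite (revenue_max ex0) ?rev0// => y ey; exact: le_V.
split; first split => //.
- by exists x0 => //; rewrite revopt.
- by move=> tau tau0; rewrite revopt; apply: revenue_le => // x; exact: le_V.
move=> zCT tau [tau0 [x ex revx] best]; apply/eqP; apply: contraT => ne.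
have : V <= outcome_revenue B tau x by rewrite revx -revopt best.
by rewrite leNgt lt_V// subr_gt0.
Qed.
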